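(* Let $G$ be a topological group with identity $e$ and let $E\subseteq G$ be the connected component of $e$ in $G$. If $E$ is compact, then $E$ is a bounded subset of $G$.
   Context: For a subset $V$ of a group and a natural number $n\ge 1$, $V^n=\{x_1x_2\cdots x_n : x_i\in V,\ 1\le i\le n\}$. A subset $E$ of a topological group $G$ with identity $e$ is called bounded if for every neighborhood $V$ of $e$ in $G$ there is a natural number $n$ such that $E\subseteq V^n$. *)

(* Defs.v *)
From HB Require Import structures.
From mathcomp Require Import all_boot.
From mathcomp Require Import all_classical topology.

Set Implicit Arguments.
Unset Strict Implicit.
Unset Printing Implicit Defensive.

Local Open Scope classical_set_scope.
Local Open Scope group_scope.

(* No separation axiom is required. *)
HB.mixin Record isTopologicalGroup G of Topological G & Group G := {
  mulg_continuous : continuous (fun x : G * G => x.1 * x.2) ;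
  invg_continuous : continuous (fun x : G => x^-1)
}.

#[short(type="topologicalGroupType")]
HB.structure Definition TopologicalGroup :=
  {G of Topological G & Group G & isTopologicalGroup G}.

(* V^n = {x_1 x_2 ... x_n : x_i in V}; only used for n >= 1. *)
Definition set_pow (G : groupType) (V : set G) (n : nat) : set G :=
  [set \prod_(i < n) x i | x in [set x : 'I_n -> G | forall i, V (x i)]].

Definition bounded_subset (G : topologicalGroupType) (E : set G) : Prop :=
  forall V : set G, nbhs (1 : G) V ->
    exists2 n : nat, (0 < n)%N & E `<=` set_pow V n.

(* Main.v *)
Require Import Defs.
From HB Require Import structures.
From mathcomp Require Import all_boot.
From mathcomp Require Import all_classical topology.

Local Open Scope classical_set_scope.
Local Open Scope group_scope.

(** For a neighbourhood [V] of [1], the union of the powers [V^n] is clopen: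
    it is open since [x * V] is a neighbourhood of [x], and closed since a
    limit point [y] has [y * V^-1] as a neighbourhood.  Hence it contains the
    connected component of [1].  The powers increase with [n] and [V^n] lies in
    the interior of [V^(n+1)], so compactness selects a single exponent. *)

Lemma set_powSr (G : groupType) (V : set G) n x v :
  set_pow V n x -> V v -> set_pow V n.+1 (x * v).
Proof.
move=> [f fV <-] Vv.
(* The new factor [v] takes the last index [ord_max]; [unlift] sends every other index back to
   ['I_n]. *)
exists (fun i : 'I_n.+1 => if unlift ord_max i is Some j then f j else v).
  by move=> i /=; case: (unlift ord_max i).
rewrite big_ord_recr /= unlift_none; congr (_ * v).
apply: eq_bigr => i _.
suff -> : widen_ord (leqnSn n) i = lift ord_max i by rewrite liftK.
by apply: val_inj; rewrite /= /bump leqNgt ltn_ord.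
Qed.

Lemma set_pow0 (G : groupType) (V : set G) : set_pow V 0 1.
Proof. by exists (fun=> 1) => [[]//|]; rewrite big_ord0. Qed.

(** A shorter product is padded on the right with factors [1]. *)
Lemma le_set_pow (G : groupType) (V : set G) m n :
  V 1 -> (m <= n)%N -> set_pow V m `<=` set_pow V n.
Proof.
move=> V1; elim: n => [|n IHn]; first by rewrite leqn0 => /eqP ->.
rewrite leq_eqVlt => /predU1P[-> //|/IHn mn] x /mn Vx.
by rewrite -[x]mulg1; exact: set_powSr.
Qed.

Section translations.
Context {G : topologicalGroupType}.
Implicit Types (V : set G) (x : G).

Lemma continuous_mulgl x : continuous (fun y : G => x * y).
Proof.
move=> y; apply: (@continuous2_cvg _ _ _ _ _ _ (fun _ => x) id (fun a b : G => a * b)).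
- exact: (@mulg_continuous G (x, y)).
- exact: cvg_cst.
- exact: cvg_id.
Qed.

Lemma nbhs_mulVg V x : nbhs (1 : G) V -> \forall y \near x, V (x^-1 * y).
Proof. by move=> V1; apply: (continuous_mulgl x^-1 x); rewrite mulVg. Qed.

Lemma nbhs_mulgV V x : nbhs (1 : G) V -> \forall y \near x, V (y^-1 * x).
Proof.
move=> V1.
have /(@invg_continuous G 1) V1' : nbhs (1^-1 : G) V by rewrite invg1.
(* Here [y^-1 * x] is the inverse of [x^-1 * y], which is near [1]. *)
by near do rewrite -[_ * x]invgK invgM invgK; exact: nbhs_mulVg V1'.
Unshelve. all: by end_near. Qed.

Lemma set_pow_near V n x : nbhs (1 : G) V -> set_pow V n x ->
  \forall y \near x, set_pow V n.+1 y.
Proof.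
move=> V1 Vx; apply: filterS (nbhs_mulVg V x V1) => y Vxy.
by rewrite -[y](mulVKg x); exact: set_powSr.
Qed.

Lemma open_bigcup_set_pow V : nbhs (1 : G) V -> open (\bigcup_n set_pow V n).
Proof.
move=> V1; rewrite openE => x [n _ Vx].
by apply: filterS (set_pow_near V n x V1 Vx) => y Vy; exists n.+1.
Qed.

Lemma closed_bigcup_set_pow V :
  nbhs (1 : G) V -> closed (\bigcup_n set_pow V n).
Proof.
move=> V1 y /(_ _ (nbhs_mulgV V y V1))[h [[n _ Vh] Vhy]].
by exists n.+1 => //; rewrite -[y](mulVKg h); exact: set_powSr.
Qed.

End translations.

Lemma connected_component_sub_clopen (T : topologicalType) (x : T) (H : set T) :
  clopen H -> H x -> connected_component [set: T] x `<=` H.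
Proof.
move=> [oH cH] Hx y [A [Ax _ cA] Ay].
(* The trace of [H] on the connected set [A] is relatively clopen and contains [x], so it is all of
   [A]. *)
have AH : A `&` H = A.
  by apply: cA; [exists x | exists H | exists H].
by move: Ay; rewrite -AH => -[].
Qed.

Theorem mainTheorem3 (G : topologicalGroupType) :
  let E : set G := connected_component [set: G] (1 : G) in
  compact E -> bounded_subset E.
Proof.
move=> E /compact_near_coveringP cE V V1.
have EH : E `<=` \bigcup_n set_pow V n.
  apply: connected_component_sub_clopen; last by exists 0%N => //; exact: set_pow0.
  by split; [exact: open_bigcup_set_pow | exact: closed_bigcup_set_pow].
(* Compactness is used as near-covering along [\oo]: local bounds on the exponent give a uniform
   one. *)
have [] := cE nat \oo (fun n x => set_pow V n x).
  move=> x /EH[m _ Vx].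
  exists (set_pow V m.+1, [set n | (m < n)%N]) => /=.
    by split; [exact: set_pow_near | exists m.+1].
  by move=> [y n] /= [Vy mn]; exact: le_set_pow (nbhs_singleton V1) mn _ Vy.
(* All exponents from [N] on work; [N.+1] is also positive. *)
by move=> N _ EV; exists N.+1 => //; exact: EV (leqnSn N).
Qed.
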